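(* For every $0\le\nu\le N$ and $m\ge1$ there is a finite threshold $\bar b^{[m]}_{A,\nu}$ such that $$\bar D^{[m]}_{A,\nu}\cap[1,\infty)=[\bar b^{[m]}_{A,\nu},\infty),\qquad\bar b^{[m+1]}_{A,\nu}\le\bar b^{[m]}_{A,\nu}.$$ Moreover $\bar b^{[m]}_{A,\nu}\le b^{[m]}_{A,\nu}$. (Thus independent random maturity enlarges the stopping region.)
   Context: Let $r\ge0$, $\alpha:=(1+r)^{-1}$, and $\lambda>1$ with $\lambda^{-1}<1+r<\lambda$. Put $p:=\frac{(1+r)-\lambda^{-1}}{\lambda-\lambda^{-1}}$, $q:=1-p$ (both in $(0,1)$), $\widetilde p:=\alpha\lambda p$, $\widetilde q:=\alpha\lambda^{-1}q$ (so $\widetilde p+\widetilde q=1$). Let $N$ be a finite horizon, $g_A(x):=(x-1)^+$ for $x>0$, $a_\nu:=\frac{\nu+1}{\nu+2}$, and for functions $\varphi$ on $(0,\infty)$ and $0\le\nu<N$ let $(\mathcal C_\nu\varphi)(x):=\widetilde p\,\varphi(\lambda^{-a_\nu}x^{a_\nu})+\widetilde q\,\varphi(\lambda^{a_\nu}x^{a_\nu})$. Fixed maturity: $J^{[0]}_\nu\equiv0$, $J^{[m]}_N=g_A$ ($m\ge1$), $J^{[m]}_\nu=\max\{g_A+\mathcal C_\nu J^{[m-1]}_{\nu+1},\ \mathcal C_\nu J^{[m]}_{\nu+1}\}$ ($0\le\nu<N$, $m\ge1$); $\Delta J^{[m]}_\nu:=J^{[m]}_\nu-J^{[m-1]}_\nu$;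 $c^{[m]}_\nu:=\mathcal C_\nu\Delta J^{[m]}_{\nu+1}$ ($\nu<N$), $c^{[m]}_N:=0$; $b^{[m]}_{A,\nu}:=\inf\{x\ge1:g_A(x)\ge c^{[m]}_\nu(x)\}$. Random maturity: $\widetilde N$ is a random variable with values in $\{0,\dots,N\}$, independent of the price process, with $\mathrm P(\widetilde N=N)>0$; $\rho_\nu:=\mathrm P(\widetilde N\ge\nu+1\mid\widetilde N\ge\nu)$ for $0\le\nu<N$; $\bar{\mathcal C}_\nu:=\rho_\nu\mathcal C_\nu$; $\bar J^{[0]}_\nu\equiv0$, $\bar J^{[m]}_N=g_A$ ($m\ge1$), $\bar J^{[m]}_\nu=\max\{g_A+\bar{\mathcal C}_\nu\bar J^{[m-1]}_{\nu+1},\ \bar{\mathcal C}_\nu\bar J^{[m]}_{\nu+1}\}$ ($0\le\nu<N$, $m\ge1$); $\Delta\bar J^{[m]}_\nu:=\bar J^{[m]}_\nu-\bar J^{[m-1]}_\nu$; $\bar c^{[m]}_\nu:=\bar{\mathcal C}_\nu\Delta\bar J^{[m]}_{\nu+1}$ ($\nu<N$), $\bar c^{[m]}_N:=0$; $\bar D^{[m]}_{A,\nu}:=\{x>0:g_A(x)\ge\bar c^{[m]}_\nu(x)\}$. *)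

(* Defs.v *)
From mathcomp Require Import all_boot all_order all_algebra.
From mathcomp Require Import all_classical all_reals all_analysis.

Set Implicit Arguments.
Unset Strict Implicit.
Unset Printing Implicit Defensive.
Import Order.TTheory GRing.Theory Num.Theory.
Import numFieldNormedType.Exports.
Local Open Scope classical_set_scope.
Local Open Scope ring_scope.

Definition up_prob {R : realType} (r lambda : R) : R :=
  ((1 + r) - lambda^-1) / (lambda - lambda^-1).

Definition down_prob {R : realType} (r lambda : R) : R :=
  1 - up_prob r lambda.

Definition tilted_up_prob {R : realType} (r lambda : R) : R :=
  (1 + r)^-1 * lambda * up_prob r lambda.

Definition tilted_down_prob {R : realType} (r lambda : R) : R :=
  (1 + r)^-1 * lambda^-1 * down_prob r lambda.

Definition payoff {R : realType} (x : R) : R := Num.max (x - 1) 0.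

Definition avg_exponent {R : realType} (nu : nat) : R := nu.+1%:R / nu.+2%:R.

Definition cont_op {R : realType} (r lambda : R) (nu : nat) (phi : R -> R)
    (x : R) : R :=
  let a := avg_exponent nu in
  tilted_up_prob r lambda * phi (lambda `^ (- a) * x `^ a) +
  tilted_down_prob r lambda * phi (lambda `^ a * x `^ a).

(* [ops nu] plays the role of the one-step operator at time [nu]. The backward
   recursion in time is run on the number [k] of periods left, that is, at
   time [N - k]; the recursion equations at time [nu] are the lemmas below. *)
Fixpoint value_left {R : realType} (ops : nat -> (R -> R) -> R -> R) (N : nat)
    (k m : nat) {struct k} : R -> R :=
  match m, k with
  | 0, _ => fun=> 0
  | _.+1, 0 => payoff
  | m'.+1, k'.+1 => fun x =>
      Num.max (payoff x + ops (N - k)%N (value_left ops N k' m') x)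
              (ops (N - k)%N (value_left ops N k' m) x)
  end.

(* meaningful for nu <= N *)
Definition value {R : realType} (ops : nat -> (R -> R) -> R -> R) (N : nat)
    (m nu : nat) : R -> R :=
  value_left ops N (N - nu) m.

Lemma value_no_right {R : realType} (ops : nat -> (R -> R) -> R -> R)
    (N nu : nat) : value ops N 0 nu = fun=> 0.
Proof. by rewrite /value; case: (N - nu)%N. Qed.

Lemma value_maturity {R : realType} (ops : nat -> (R -> R) -> R -> R)
    (N m : nat) : value ops N m.+1 N = payoff.
Proof. by rewrite /value subnn. Qed.

Lemma value_step {R : realType} (ops : nat -> (R -> R) -> R -> R)
    (N m nu : nat) (x : R) : (nu < N)%N ->
  value ops N m.+1 nu x =
    Num.max (payoff x + ops nu (value ops N m nu.+1) x)
            (ops nu (value ops N m.+1 nu.+1) x).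
Proof.
move=> nuN; have nuE : (N - (N - nu.+1).+1 = nu)%N.
  by rewrite subnSK// subKn// ltnW.
by rewrite /value -(subnSK nuN) /= nuE.
Qed.

(* used for m >= 1 only *)
Definition marginal_value {R : realType} (ops : nat -> (R -> R) -> R -> R)
    (N m nu : nat) (x : R) : R :=
  value ops N m nu x - value ops N m.-1 nu x.

Definition marginal_cont {R : realType} (ops : nat -> (R -> R) -> R -> R)
    (N m nu : nat) (x : R) : R :=
  if (nu < N)%N then ops nu (marginal_value ops N m nu.+1) x else 0.

Definition stop_region {R : realType} (ops : nat -> (R -> R) -> R -> R)
    (N m nu : nat) : set R :=
  [set x | 0 < x /\ payoff x >= marginal_cont ops N m nu x].

(* an infimum in the extended reals, with value +oo on the empty set *)
Definition threshold {R : realType} (ops : nat -> (R -> R) -> R -> R)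
    (N m nu : nat) : \bar R :=
  ereal_inf
    (EFin @` [set x | 1 <= x /\ payoff x >= marginal_cont ops N m nu x]).

Definition cond_prob {d : measure_display} {T : measurableType d}
    {R : realType} (P : probability T R) (A B : set T) : R :=
  fine (P (A `&` B)) / fine (P B).

Definition survival_prob {d : measure_display} {T : measurableType d}
    {R : realType} (P : probability T R) (Nt : T -> nat) (nu : nat) : R :=
  cond_prob P [set w | (nu.+1 <= Nt w)%N] [set w | (nu <= Nt w)%N].

Definition random_cont_op {d : measure_display} {T : measurableType d}
    {R : realType} (P : probability T R) (Nt : T -> nat) (r lambda : R)
    (nu : nat) (phi : R -> R) (x : R) : R :=
  survival_prob P Nt nu * cont_op r lambda nu phi x.

(* The N steps, each a factor lambda or lambda^-1, are i.i.d.: the joint law of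
   the steps is the product law with weight p for lambda. *)
Definition binomial_price_process {d : measure_display} {T : measurableType d}
    {R : realType} (P : probability T R) (p lambda : R) (N : nat)
    (S : nat -> T -> R) : Prop :=
  (exists2 s0 : R, 0 < s0 & forall w, S 0%N w = s0) /\
  forall u : {ffun 'I_N -> bool},
    P [set w | forall k : 'I_N,
         S k.+1 w = S k w * (if u k then lambda else lambda^-1)] =
    (\prod_(k < N) (if u k then p else 1 - p))%:E.

(* sigma(Nt) and sigma(S 0, ..., S N) are independent *)
Definition independent_of_process {d : measure_display}
    {T : measurableType d} {R : realType} (P : probability T R) (N : nat)
    (Nt : T -> nat) (S : nat -> T -> R) : Prop :=
  forall A B : set T,
    preimage_set_system setT Nt measurable A ->
    <<s \bigcup_(k in [set k | (k <= N)%N])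
          preimage_set_system setT (S k) measurable >> B ->
    P (A `&` B) = (P A * P B)%E.

(* Main.v *)
Require Import Defs.
From mathcomp Require Import all_boot all_order all_algebra.
From mathcomp Require Import all_classical all_reals all_analysis.
From mathcomp Require Import lra.
Import Order.TTheory GRing.Theory Num.Theory.
Import numFieldNormedType.Exports.
Local Open Scope classical_set_scope.
Local Open Scope ring_scope.

(* On (0, +oo), consider the class of functions f such that f >= 0,
   f is nondecreasing and (f x + 1) / x is nonincreasing.  It contains the
   payoff and is stable under max, min and the one-step operators with survival
   factor in [0, 1]; the last point holds because x |-> x ^ a / x is
   nonincreasing for a <= 1.  The marginal values satisfy
   D^1 = max(g, c^1) and D^(m+1) = min(c^m, max(g, c^(m+1))), so by backward
   induction they belong to the class, decrease in m and increase with the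
   survival factors.  For x >= 1 the inequality g x >= c x reads
   (c x + 1) / x <= 1, hence the stopping region is upward closed; it is closed
   because c is nondecreasing, and nonempty because c grows at most like x ^ a
   with a < 1. *)

(** The third clause is the monotonicity of [(f x + 1) / x] with denominators cleared. *)
Definition tame {R : realType} (f : R -> R) : Prop :=
  [/\ forall x, 0 < x -> 0 <= f x,
      forall x y, 0 < x -> x <= y -> f x <= f y
    & forall x y, 0 < x -> x <= y -> (f y + 1) * x <= (f x + 1) * y].

(** One form for both models: [rho = survival_prob P Nt] gives [random_cont_op] by conversion, and
    [rho = 1] gives [cont_op]. *)
Definition killed_cont_op {R : realType} (r lambda : R) (rho : nat -> R)
    (nu : nat) (phi : R -> R) (x : R) : R :=
  rho nu * cont_op r lambda nu phi x.

(** * Closure properties of tame functions *)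

Section Tame.
Context {R : realType}.
Implicit Types (f g : R -> R) (x y : R).

(** The min-max recursion for the marginal values is obtained only at positive arguments, so
    tameness is transferred along equality there. *)
Lemma eq_tame f g : (forall x, 0 < x -> f x = g x) -> tame f -> tame g.
Proof.
move=> fg [f0 fm fs]; split=> [x x0|x y x0 xy|x y x0 xy].
- by rewrite -fg// f0.
- by rewrite -!fg ?fm// (lt_le_trans x0).
- by rewrite -!fg ?fs// (lt_le_trans x0).
Qed.

Lemma tame_cst0 : tame (fun=> 0 : R).
Proof. by split=> // x y _ xy; rewrite add0r !mul1r. Qed.

Lemma tame_payoff : tame (@payoff R).
Proof.
rewrite /payoff; split=> [x _|x y x0 xy|x y x0 xy].
- by rewrite le_max lexx orbT.
- by rewrite ge_max !le_max lexx orbT andbT lerB.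
- have y0 := lt_le_trans x0 xy.
  (* Since [payoff x + 1 = max x 1], the claim is [max y 1 * x <= max x 1 * y]. *)
  rewrite !addr_maxl !subrK !add0r !maxr_pMl ?(ltW x0) ?(ltW y0)//.
  by rewrite !mul1r mulrC ge_max !le_max lexx xy orbT.
Qed.

Lemma tame_max f g :
  tame f -> tame g -> tame (fun x => Num.max (f x) (g x)).
Proof.
move=> [f0 fm fs] [g0 gm gs]; split=> [x x0|x y x0 xy|x y x0 xy].
- by rewrite le_max f0.
- by rewrite ge_max !le_max fm// gm// orbT.
- have y0 := lt_le_trans x0 xy.
  have [_|_] := leP (f y) (g y).
  + by apply: le_trans (gs _ _ x0 xy) _; rewrite ler_pM2r// lerD2r le_max lexx orbT.
  + by apply: le_trans (fs _ _ x0 xy) _; rewrite ler_pM2r// lerD2r le_max lexx.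
Qed.

Lemma tame_min f g :
  tame f -> tame g -> tame (fun x => Num.min (f x) (g x)).
Proof.
move=> [f0 fm fs] [g0 gm gs]; split=> [x x0|x y x0 xy|x y x0 xy].
- by rewrite le_min f0// g0.
- by rewrite le_min !ge_min fm// gm// orbT.
- have [_|_] := leP (f x) (g x).
  + by apply: le_trans (fs _ _ x0 xy); rewrite ler_pM2r// lerD2r ge_min lexx.
  + by apply: le_trans (gs _ _ x0 xy); rewrite ler_pM2r// lerD2r ge_min lexx orbT.
Qed.

(** With [u = k * x ^ a], the quotient [(f u + 1) / x] equals [k * ((f u + 1) / u) * x ^ (a - 1)], a
    product of nonnegative nonincreasing factors; [a <= 1] gives the last one. The proof clears
    denominators by splitting [x = x ^ a * x ^ (1 - a)]. *)
Lemma tame_comp_powR f (k a : R) : 0 < k -> 0 <= a <= 1 ->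
  tame f -> tame (fun x => f (k * x `^ a)).
Proof.
move=> k0 /andP[a0 a1] [f0 fm fs].
have kx0 x : 0 < x -> 0 < k * x `^ a by move=> x0; rewrite mulr_gt0// powR_gt0.
have kxm x y : 0 < x -> x <= y -> k * x `^ a <= k * y `^ a.
  move=> x0 xy; rewrite ler_pM2l// ge0_ler_powR// nnegrE ltW//.
  exact: lt_le_trans xy.
split=> [x x0|x y x0 xy|x y x0 xy]; first exact/f0/kx0.
  by apply: fm; [exact: kx0|exact: kxm].
have y0 := lt_le_trans x0 xy.
have := fs _ _ (kx0 _ x0) (kxm _ _ x0 xy).
have powE z : 0 < z -> z = z `^ a * z `^ (1 - a).
  by move=> z0; rewrite -powRD ?subrKC ?powRr1 ?ltW// (gt_eqF z0) implybT.
have b01 : x `^ (1 - a) <= y `^ (1 - a).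
  by rewrite ge0_ler_powR// ?subr_ge0// nnegrE ltW.
rewrite [leLHS]mulrCA [leRHS]mulrCA (ler_pM2l k0) => H.
rewrite [leLHS](_ : _ = (f (k * y `^ a) + 1) * x `^ a * x `^ (1 - a)); last first.
  by rewrite -mulrA -powE.
rewrite [leRHS](_ : _ = (f (k * x `^ a) + 1) * y `^ a * y `^ (1 - a)); last first.
  by rewrite -mulrA -powE.
apply: ler_pM => //; rewrite ?powR_ge0// mulr_ge0 ?powR_ge0//.
by rewrite addr_ge0// f0// kx0.
Qed.

(** As [s f + t g + 1 = s (f + 1) + t (g + 1) + (1 - (s + t))], the missing weight only adds a
    nonnegative constant, whose quotient by [x] is nonincreasing. *)
Lemma tame_convex f g (s t : R) : 0 <= s -> 0 <= t -> s + t <= 1 ->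
  tame f -> tame g -> tame (fun x => s * f x + t * g x).
Proof.
move=> s0 t0 st1 [f0 fm fs] [g0 gm gs]; split=> [x x0|x y x0 xy|x y x0 xy].
- by rewrite addr_ge0// mulr_ge0// ?f0 ?g0.
- by rewrite lerD// ler_wpM2l// ?fm ?gm.
- have Hf := ler_wpM2l s0 (fs _ _ x0 xy).
  have Hg := ler_wpM2l t0 (gs _ _ x0 xy).
  have : 0 <= (1 - (s + t)) * (y - x) by rewrite mulr_ge0// subr_ge0.
  lra.
Qed.

End Tame.

(** * Operators with a survival factor and their marginal values *)

Section KilledContinuation.
Context {R : realType} (r lambda : R).
Hypothesis (lambda_gt1 : 1 < lambda).
Hypotheses (r_gt : lambda^-1 < 1 + r) (r_lt : 1 + r < lambda).

Let lambda_gt0 : 0 < lambda. Proof. exact: lt_trans lambda_gt1. Qed.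
Let spread_gt0 : 0 < lambda - lambda^-1.
Proof. by rewrite subr_gt0 (lt_trans r_gt r_lt). Qed.

Let compound_gt0 : 0 < 1 + r.
Proof. by rewrite (lt_trans _ r_gt)// invr_gt0. Qed.

Lemma tilted_up_prob_ge0 : 0 <= tilted_up_prob r lambda.
Proof.
rewrite /tilted_up_prob /up_prob ltW// !mulr_gt0 ?invr_gt0//.
by rewrite subr_gt0.
Qed.

Lemma tilted_down_prob_ge0 : 0 <= tilted_down_prob r lambda.
Proof.
rewrite /tilted_down_prob /down_prob /up_prob ltW// !mulr_gt0 ?invr_gt0//.
by rewrite subr_gt0 ltr_pdivrMr// mul1r ltrD2r.
Qed.

(** Amounts to the martingale identity [lambda * p + lambda^-1 * (1 - p) = 1 + r] that determines
    [p]. *)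
Lemma tilted_prob_sum : tilted_up_prob r lambda + tilted_down_prob r lambda = 1.
Proof.
have r1 : 1 + r != 0 by rewrite gt_eqF.
have l0 : lambda != 0 by rewrite gt_eqF.
have s0 : lambda - lambda^-1 != 0 by rewrite gt_eqF.
rewrite /tilted_up_prob /tilted_down_prob /down_prob.
have : up_prob r lambda * (lambda - lambda^-1) = 1 + r - lambda^-1.
  by rewrite /up_prob divfK.
move: (up_prob r lambda) => p pE.
rewrite -!mulrA -mulrDr; apply: (mulfI r1); rewrite mulVKf// mulr1.
by rewrite mulrBr mulr1 addrCA (mulrC lambda) (mulrC lambda^-1 p) -mulrBr pE subrKC.
Qed.

Lemma avg_exponent_itv nu : 0 <= (avg_exponent nu : R) <= 1.
Proof.
by rewrite /avg_exponent divr_ge0//= ler_pdivrMr// mul1r ler_nat.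
Qed.

Variable rho : nat -> R.
Hypotheses (rho_ge0 : forall nu, 0 <= rho nu) (rho_le1 : forall nu, rho nu <= 1).

Lemma killed_cont_opB nu (f g : R -> R) x :
  killed_cont_op r lambda rho nu (fun y => f y - g y) x =
  killed_cont_op r lambda rho nu f x - killed_cont_op r lambda rho nu g x.
Proof. by rewrite /killed_cont_op /cont_op; lra. Qed.

Lemma tame_killed_cont_op nu (f : R -> R) :
  tame f -> tame (killed_cont_op r lambda rho nu f).
Proof.
move=> tf; set a : R := avg_exponent nu.
apply: (eq_tame (fun x =>
    rho nu * tilted_up_prob r lambda * f (lambda `^ (- a) * x `^ a) +
    rho nu * tilted_down_prob r lambda * f (lambda `^ a * x `^ a))).
  by move=> x _; rewrite /killed_cont_op /cont_op mulrDr !mulrA.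
apply: tame_convex.
- by rewrite mulr_ge0// tilted_up_prob_ge0.
- by rewrite mulr_ge0// tilted_down_prob_ge0.
- by rewrite -mulrDr tilted_prob_sum mulr1.
- by apply: tame_comp_powR => //; [rewrite powR_gt0|exact: avg_exponent_itv].
- by apply: tame_comp_powR => //; [rewrite powR_gt0|exact: avg_exponent_itv].
Qed.

Lemma le_cont_op nu (f g : R -> R) x : 0 < x ->
  (forall y, 0 < y -> f y <= g y) ->
  cont_op r lambda nu f x <= cont_op r lambda nu g x.
Proof.
move=> x0 fg; rewrite /cont_op lerD// ler_wpM2l ?tilted_up_prob_ge0
  ?tilted_down_prob_ge0// fg// mulr_gt0// powR_gt0//.
Qed.

Lemma cont_op_ge0 nu (f : R -> R) x : 0 < x -> (forall y, 0 < y -> 0 <= f y) ->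
  0 <= cont_op r lambda nu f x.
Proof.
move=> x0 f0; apply: le_trans (le_cont_op nu _ _ _ x0 f0).
by rewrite /cont_op !mulr0 addr0.
Qed.

Lemma le_killed_cont_op nu (f g : R -> R) x : 0 < x ->
  (forall y, 0 < y -> f y <= g y) ->
  killed_cont_op r lambda rho nu f x <= killed_cont_op r lambda rho nu g x.
Proof. by move=> x0 fg; rewrite ler_wpM2l// le_cont_op. Qed.

(* Tameness gives f y + 1 <= (f 1 + 1) y for y >= 1; at x = K ^ (nu + 2) with
   K = (f 1 + 1) lambda one has x ^ a = K ^ (nu + 1), so both values of f in the
   operator are at most x - 1. *)
Lemma killed_cont_op_le_payoff nu (f : R -> R) : tame f ->
  exists2 x, 1 <= x & killed_cont_op r lambda rho nu f x <= payoff x.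
Proof.
move=> [f0 fm fs].
pose K := (f 1 + 1) * lambda.
have f1 : 1 <= f 1 + 1 by rewrite lerDr f0.
have lK : lambda <= K by rewrite ler_peMl// ltW.
have K1 : 1 <= K by rewrite (le_trans _ lK)// ltW.
have K0 : 0 < K by rewrite (lt_le_trans _ K1).
have KnE : (K ^+ nu.+2) `^ avg_exponent nu = K ^+ nu.+1.
  rewrite -!powR_mulrn ?ltW// -powRrM /avg_exponent.
  by rewrite mulrCA divff ?mulr1// pnatr_eq0.
exists (K ^+ nu.+2); first exact: exprn_ege1.
have C_ge0 : 0 <= cont_op r lambda nu f (K ^+ nu.+2).
  by rewrite cont_op_ge0 ?exprn_gt0.
rewrite le_max; apply/orP; left.
apply: le_trans (_ : cont_op r lambda nu f (K ^+ nu.+2) <= _).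
  by rewrite /killed_cont_op ler_piMl.
rewrite lerBrDr.
have bound k : lambda^-1 <= k -> k <= lambda -> f (k * K ^+ nu.+1) <= K ^+ nu.+2 - 1.
  move=> lk kl; have k0 : 0 < k by rewrite (lt_le_trans _ lk)// invr_gt0.
  have kK : 1 <= k * K ^+ nu.+1.
    apply: le_trans (_ : lambda^-1 * lambda <= _).
      by rewrite mulVf// gt_eqF.
    apply: ler_pM => //; rewrite ?invr_ge0 ?(ltW lambda_gt0)//.
    by apply: le_trans lK _; rewrite exprS ler_peMr ?exprn_ege1// (ltW K0).
  (* The factor [lambda] in [K] absorbs [k]: [(f 1 + 1) * k * K ^+ nu.+1 <= K ^+ nu.+2]. *)
  have := fs 1 _ ltr01 kK; rewrite mulr1 -lerBrDr => /le_trans; apply.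
  rewrite lerB// mulrA [leRHS]exprS ler_pM2r ?exprn_gt0//.
  by rewrite ler_wpM2l// (le_trans _ f1).
have a01 := avg_exponent_itv nu; case/andP: (a01) => a0 a1.
have lal : lambda `^ avg_exponent nu <= lambda.
  by rewrite -[leRHS](powRr1 (ltW lambda_gt0)) ler_powR// ltW.
have lVal : lambda^-1 <= lambda `^ (- avg_exponent nu).
  by rewrite powRN lef_pV2 ?posrE// powR_gt0.
have la1 : 1 <= lambda `^ avg_exponent nu.
  by rewrite -[leLHS](powRr0 lambda) ler_powR// ltW.
have B1 : f (lambda `^ (- avg_exponent nu) * K ^+ nu.+1) <= K ^+ nu.+2 - 1.
  apply: bound => //; apply: le_trans (ltW lambda_gt1).
  by rewrite powRN invf_le1// powR_gt0.
have B2 : f (lambda `^ avg_exponent nu * K ^+ nu.+1) <= K ^+ nu.+2 - 1.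
  by apply: bound => //; apply: le_trans la1; rewrite invf_le1// ltW.
rewrite /cont_op KnE.
have := ler_wpM2l tilted_up_prob_ge0 B1.
have := ler_wpM2l tilted_down_prob_ge0 B2.
have := tilted_prob_sum; nra.
Qed.

Variable N : nat.
Let ops := killed_cont_op r lambda rho.
Let D := marginal_value ops N.

Lemma marginal_contE m nu : (nu < N)%N ->
  marginal_cont ops N m nu = ops nu (D m nu.+1).
Proof. by rewrite /marginal_cont => ->. Qed.

(** By linearity both branches of the maximum contain the continuation value of [m] rights, which is
    pulled out. *)
Let valueE m nu x : (nu < N)%N -> value ops N m.+1 nu x =
  ops nu (value ops N m nu.+1) x + Num.max (payoff x) (ops nu (D m.+1 nu.+1) x).
Proof.
move=> nuN; rewrite value_step// [in RHS]/ops killed_cont_opB/=.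
by rewrite addr_maxr addrC subrKC.
Qed.

Lemma marginal_value1 nu x : (nu < N)%N ->
  D 1 nu x = Num.max (payoff x) (ops nu (D 1 nu.+1) x).
Proof.
move=> nuN; rewrite {1}/D /marginal_value valueE// !value_no_right subr0.
by rewrite [X in X + _](_ : _ = 0) ?add0r// /ops /killed_cont_op /cont_op !mulr0 addr0 mulr0.
Qed.

(** Write [c], [c'] for the continuations of [D m.+1], [D m.+2] and [g] for the payoff. Subtracting
    two instances of [valueE] gives [c + max g c' - max g c]; when [c' <= c] this is [c] if [g >= c]
    and [max g c'] otherwise, hence the minimum of the two. *)
Lemma marginal_valueS m nu x : (nu < N)%N ->
  ops nu (D m.+2 nu.+1) x <= ops nu (D m.+1 nu.+1) x ->
  D m.+2 nu x = Num.min (ops nu (D m.+1 nu.+1) x)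
                        (Num.max (payoff x) (ops nu (D m.+2 nu.+1) x)).
Proof.
move=> nuN; rewrite {3}/D /marginal_value/= !valueE//.
have -> : ops nu (value ops N m.+1 nu.+1) x =
    ops nu (value ops N m nu.+1) x + ops nu (D m.+1 nu.+1) x.
  by rewrite [ops nu (D _ _) _]killed_cont_opB subrKC.
move: (ops nu (value _ _ _ _) x) (ops nu (D m.+1 nu.+1) x)
  (ops nu (D m.+2 nu.+1) x) (payoff x) => v c c' g c'c.
by rewrite /Num.min; have [?|?] := leP g c; have [?|?] := leP g c'; case: ifPn; rewrite -?leNgt => ?; lra.
Qed.

(** Both claims go through one backward induction, since the min-max formula behind tameness at [nu]
    requires the decrease in [m] at [nu.+1]. *)
Lemma marginal_value_tame_decr nu : (nu <= N)%N ->
  (forall m, tame (D m.+1 nu)) /\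
  (forall m x, 0 < x -> D m.+2 nu x <= D m.+1 nu x).
Proof.
move=> nuN; rewrite -(subKn nuN); move: (N - nu)%N (leq_subr nu N) => k.
elim: k => [_|k IH kN].
  (* At maturity at most one exercise takes place, so further rights add nothing. *)
  have DN1 : D 1 N = payoff.
    by apply/funext => x; rewrite /D /marginal_value value_maturity value_no_right subr0.
  have DNS m : D m.+2 N = fun=> 0.
    by apply/funext => x; rewrite /D /marginal_value !value_maturity subrr.
  rewrite subn0; split=> [[|m]|[|m] x x0]; rewrite ?DN1 ?DNS//.
  - exact: tame_payoff.
  - exact: tame_cst0.
  - by case: (@tame_payoff R) => -> .
have [tD dD] := IH (ltnW kN).
have lt : (N - k.+1 < N)%N by rewrite ltn_subrL (leq_ltn_trans _ kN).
rewrite -(subnSK kN) in tD dD.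
move: (N - k.+1)%N lt tD dD => {k IH kN nuN} {}nu nuN tD dD.
have tC m : tame (ops nu (D m.+1 nu.+1)) by exact: tame_killed_cont_op.
have dC m x : 0 < x -> ops nu (D m.+2 nu.+1) x <= ops nu (D m.+1 nu.+1) x.
  by move=> x0; apply: le_killed_cont_op => // y; exact: dD.
split=> [[|m]|[|m] x x0].
- apply: (eq_tame (fun x => Num.max (payoff x) (ops nu (D 1 nu.+1) x))).
    by move=> x _; rewrite marginal_value1.
  by apply: tame_max => //; exact: tame_payoff.
- apply: (eq_tame (fun x => Num.min (ops nu (D m.+1 nu.+1) x)
      (Num.max (payoff x) (ops nu (D m.+2 nu.+1) x)))).
    by move=> x x0; rewrite marginal_valueS// dC.
  by apply: tame_min => //; apply: tame_max => //; exact: tame_payoff.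
- by rewrite marginal_valueS ?dC// marginal_value1// ge_min le_max lexx orbT.
(* The two sides are separated by [ops nu (D m.+2 nu.+1) x]. *)
- rewrite [leLHS]marginal_valueS ?dC// [leRHS]marginal_valueS ?dC// ge_min.
  by rewrite le_min dC// le_max lexx orbT.
Qed.

Lemma tame_marginal_cont m nu : (nu <= N)%N -> tame (marginal_cont ops N m.+1 nu).
Proof.
rewrite leq_eqVlt => /predU1P[->|nuN].
  by rewrite /marginal_cont ltnn; exact: tame_cst0.
rewrite marginal_contE//; apply: tame_killed_cont_op.
by case: (marginal_value_tame_decr _ nuN).
Qed.

Lemma marginal_cont_decr m nu x : (nu <= N)%N -> 0 < x ->
  marginal_cont ops N m.+2 nu x <= marginal_cont ops N m.+1 nu x.
Proof.
rewrite leq_eqVlt => /predU1P[->|nuN] x0; first by rewrite /marginal_cont ltnn.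
rewrite !marginal_contE//; apply: le_killed_cont_op => // y.
by have [_] := marginal_value_tame_decr _ nuN; apply.
Qed.

Lemma marginal_cont_le_payoff m nu : (nu <= N)%N ->
  exists2 x, 1 <= x & marginal_cont ops N m.+1 nu x <= payoff x.
Proof.
rewrite leq_eqVlt => /predU1P[->|nuN].
  by exists 1 => //; rewrite /marginal_cont ltnn /payoff le_max lexx orbT.
rewrite marginal_contE//; apply: killed_cont_op_le_payoff.
by case: (marginal_value_tame_decr _ nuN).
Qed.

End KilledContinuation.

(** * Monotonicity in the survival factors *)

Section Comparison.
Context {R : realType} (r lambda : R).
Hypothesis (lambda_gt1 : 1 < lambda).
Hypotheses (r_gt : lambda^-1 < 1 + r) (r_lt : 1 + r < lambda).
Variables (rho rho' : nat -> R) (N : nat).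
Hypotheses (rho_ge0 : forall nu, 0 <= rho nu) (rho_le : forall nu, rho nu <= rho' nu).
Hypothesis rho'_le1 : forall nu, rho' nu <= 1.

Let rho_le1 nu : rho nu <= 1. Proof. exact: le_trans (rho'_le1 nu). Qed.
Let rho'_ge0 nu : 0 <= rho' nu. Proof. exact: le_trans (rho_le nu). Qed.
Let ops := killed_cont_op r lambda rho.
Let ops' := killed_cont_op r lambda rho'.

(** Nonnegativity of [f] lets a larger survival factor increase the product. *)
Lemma le_killed_cont_op2 nu (f g : R -> R) x : 0 < x ->
  (forall y, 0 < y -> 0 <= f y) -> (forall y, 0 < y -> f y <= g y) ->
  ops nu f x <= ops' nu g x.
Proof.
move=> x0 f0 fg; apply: ler_pM => //; last exact: le_cont_op.
exact: cont_op_ge0.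
Qed.

(** A difference of values is not visibly monotone in [rho], but the min-max formulas are monotone
    in the continuations, so the comparison propagates backward in time. *)
Lemma le_marginal_value nu m x : (nu <= N)%N -> 0 < x ->
  marginal_value ops N m.+1 nu x <= marginal_value ops' N m.+1 nu x.
Proof.
move=> nuN; rewrite -(subKn nuN).
elim: (N - nu)%N (leq_subr nu N) m x => [_ m x x0|k IH kN m x x0].
  by rewrite subn0 /marginal_value; case: m => [|m];
    rewrite ?value_maturity ?value_no_right.
have {}IH := IH (ltnW kN).
have lt : (N - k.+1 < N)%N by rewrite ltn_subrL (leq_ltn_trans _ kN).
rewrite -(subnSK kN) in IH.
move: (N - k.+1)%N lt IH => {k kN nuN} {}nu nuN IH.
have [tD dD] := marginal_value_tame_decr r lambda lambda_gt1 r_gt r_lt rho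
  rho_ge0 rho_le1 N nu.+1 nuN.
have [_ dD'] := marginal_value_tame_decr r lambda lambda_gt1 r_gt r_lt rho'
  rho'_ge0 rho'_le1 N nu.+1 nuN.
have leC n : ops nu (marginal_value ops N n.+1 nu.+1) x <=
    ops' nu (marginal_value ops' N n.+1 nu.+1) x.
  by apply: le_killed_cont_op2 => // y y0; [case: (tD n) => + _ _; exact|exact: IH].
case: m => [|m].
  rewrite [leLHS]marginal_value1// [leRHS]marginal_value1//.
  by move: (payoff x) => g; rewrite ge_max !le_max lexx leC orbT.
have dC : ops nu (marginal_value ops N m.+2 nu.+1) x <=
    ops nu (marginal_value ops N m.+1 nu.+1) x.
  by apply: le_killed_cont_op => // y; exact: dD.
have dC' : ops' nu (marginal_value ops' N m.+2 nu.+1) x <=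
    ops' nu (marginal_value ops' N m.+1 nu.+1) x.
  by apply: le_killed_cont_op => // y; exact: dD'.
rewrite [leLHS]marginal_valueS// [leRHS]marginal_valueS//.
by move: (payoff x) => g; rewrite le_min !ge_min leC/= ge_max !le_max lexx leC !orbT.
Qed.

Lemma le_marginal_cont nu m x : (nu <= N)%N -> 0 < x ->
  marginal_cont ops N m.+1 nu x <= marginal_cont ops' N m.+1 nu x.
Proof.
rewrite leq_eqVlt => /predU1P[->|nuN] x0; first by rewrite /marginal_cont ltnn.
rewrite !marginal_contE//; apply: le_killed_cont_op2 => // y y0.
  have [tD _] := marginal_value_tame_decr r lambda lambda_gt1 r_gt r_lt rho
    rho_ge0 rho_le1 N nu.+1 nuN.
  by case: (tD m) => + _ _; exact.
exact: le_marginal_value.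
Qed.

End Comparison.

(** * Stopping sets as closed half-lines, and the thresholds *)

Lemma tame_stop_setE {R : realType} (c : R -> R) : tame c ->
  (exists2 x, 1 <= x & c x <= payoff x) ->
  [set x | 1 <= x /\ payoff x >= c x] =
  `[inf [set x | 1 <= x /\ payoff x >= c x], +oo[%classic.
Proof.
move=> [c0 cm cs] [z z1 cz]; set S := [set x | _].
have payoffE x : 1 <= x -> payoff x = x - 1.
  by move=> x1; rewrite /payoff max_l// subr_ge0.
have hS : has_inf S by split; [exists z|exists 1 => x []].
have inf1 : 1 <= inf S by apply: lb_le_inf; [case: hS|move=> x []].
(* For [x] in [S], [c (inf S) + 1 <= c x + 1 <= x]; so [c (inf S) + 1] is a lower bound of [S], and
   the infimum is attained. *)
have Sinf : S (inf S).
  split=> //; rewrite payoffE// lerBrDr.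
  apply: lb_le_inf; [by case: hS|move=> x Sx].
  have [x1] := Sx; rewrite payoffE// lerBrDr; apply: le_trans.
  rewrite lerD2r cm ?(lt_le_trans _ inf1)//.
  by apply: ge_inf => //; case: hS.
apply/seteqP; split=> x /=; rewrite in_itv/= andbT; [move=> Sx|move=> xS].
  by apply: ge_inf => //; case: hS.
have x1 := le_trans inf1 xS; split=> //.
have inf0 := lt_le_trans ltr01 inf1.
case: Sinf => _; rewrite !payoffE// !lerBrDr => ci.
(* Upward closure: [(c x + 1) * inf S <= (c (inf S) + 1) * x <= inf S * x]. *)
rewrite -(ler_pM2r inf0); apply: le_trans (cs _ _ inf0 xS) _.
by rewrite mulrC ler_pM2l// (lt_le_trans _ x1).
Qed.

Lemma survival_prob_itv {d : measure_display} {T : measurableType d}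
    {R : realType} (P : probability T R) (Nt : {RV P >-> nat}) nu :
  0 <= survival_prob P Nt nu <= 1.
Proof.
have mB k : measurable [set w | (k <= Nt w)%N].
  exact: (measurable_funPTI Nt (Y := [set n | (k <= n)%N])).
rewrite /survival_prob /cond_prob.
set A := [set w | (nu.+1 <= Nt w)%N]; set B := [set w | (nu <= Nt w)%N].
have mAB : measurable (A `&` B) by apply: measurableI; exact: mB.
have AB : (P (A `&` B) <= P B)%E.
  by apply: le_measure; [rewrite inE|rewrite inE; exact: mB|exact: subIsetr].
have fB : P B \is a fin_num by apply: fin_num_measure; exact: mB.
have fAB : P (A `&` B) \is a fin_num by exact: fin_num_measure.
rewrite divr_ge0 ?fine_ge0//=.
(* Conditioning on a null event yields 0, by the convention for division. *)
have [->|B0] := eqVneq (fine (P B)) 0; first by rewrite invr0 mulr0.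
by rewrite ler_pdivrMr ?mul1r ?fine_le// lt_neqAle eq_sym B0 fine_ge0.
Qed.

Theorem corollary6p9 (R : realType) (r lambda : R)
    (r_ge0 : 0 <= r) (lambda_gt1 : 1 < lambda)
    (r_gt : lambda^-1 < 1 + r) (r_lt : 1 + r < lambda) (N : nat)
    (d : measure_display) (T : measurableType d) (P : probability T R)
    (price : nat -> {RV P >-> R})
    (price_binomial : binomial_price_process P (up_prob r lambda) lambda N price)
    (Nt : {RV P >-> nat}) (Nt_le : forall w, (Nt w <= N)%N)
    (Nt_indep : independent_of_process P N Nt price)
    (Nt_pos : (0 < P [set w | Nt w = N])%E) :
  exists bbar : nat -> nat -> R,
    forall nu m : nat, (nu <= N)%N -> (1 <= m)%N ->
      [/\ stop_region (random_cont_op P Nt r lambda) N m nu `&` `[1, +oo[%classic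
            = `[bbar m nu, +oo[%classic,
          bbar m.+1 nu <= bbar m nu
        & ((bbar m nu)%:E <= threshold (cont_op r lambda) N m nu)%E].
Proof.
pose rho := survival_prob P Nt; pose ops := killed_cont_op r lambda rho.
have rho0 nu : 0 <= rho nu by case/andP: (survival_prob_itv P Nt nu).
have rho1 nu : rho nu <= 1 by case/andP: (survival_prob_itv P Nt nu).
have opsE : cont_op r lambda = killed_cont_op r lambda (fun=> 1).
  by apply/funext => nu; apply/funext => f; apply/funext => x; rewrite /killed_cont_op mul1r.
pose S m nu := [set x | 1 <= x /\ payoff x >= marginal_cont ops N m nu x].
exists (fun m nu => inf (S m nu)) => nu [//|m] nuN _.
have SE n : S n.+1 nu = `[inf (S n.+1 nu), +oo[%classic.
  apply: tame_stop_setE; first exact: tame_marginal_cont.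
  exact: marginal_cont_le_payoff.
have infP n x : S n.+1 nu x -> inf (S n.+1 nu) <= x.
  by rewrite {1}SE/= in_itv/= andbT.
split.
- rewrite -SE; apply/seteqP; split=> x /=; rewrite in_itv/= andbT.
    by move=> [[_ cx] x1].
  by move=> [x1 cx]; do !split=> //; exact: lt_le_trans x1.
(* The threshold for [m.+1] rights is attained, and it stays in the stopping set when one more right
   lowers the continuation. *)
- apply: infP; have : S m.+1 nu (inf (S m.+1 nu)) by rewrite {1}SE/= in_itv/= lexx.
  move=> [x1 cx]; split=> //; apply: le_trans cx.
  by apply: marginal_cont_decr => //; exact: lt_le_trans x1.
(* Fixed maturity is survival factor 1, with larger continuation; each of its stopping points above
   1 therefore lies in [S m.+1 nu]. *)
- rewrite opsE; apply: le_ereal_inf_tmp => _ [x [x1 cx] <-]; rewrite lee_fin; apply: infP.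
  split=> //; apply: le_trans cx.
  by apply: le_marginal_cont => //; exact: lt_le_trans x1.
Qed.
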